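(* Let $a,b$ be integers with $0<a<b$ and $a\geq 2$, and let \[T_{U_{a,b}}(x,y)=\sum_{i=0}^{a}\binom{b}{i}(x-1)^{a-i}+\sum_{j=a+1}^b\binom{b}{j}(y-1)^{j-a}\] be the Tutte polynomial of the uniform matroid $U_{a,b}$ (groundset $\{1,\ldots,b\}$, bases all $a$-element subsets). Then: (1) $G_{\mathbf{Q},y}(T_{U_{a,b}})\simeq\mathfrak S_a$ if $b$ is sufficiently large in terms of $a$; (2) if $b=a+p$ for some prime number $p>a$, then $G_{\mathbf{Q},y}(T_{U_{a,b}})$ acts as a primitive permutation group on the roots of $T_{U_{a,b}}$ (as a polynomial in $x$) in a fixed algebraic closure of $\mathbf{Q}(y)$; if in addition $a$ is composite, this action is doubly transitive.
   Context: $G_{\mathbf{Q},y}(T)$ denotes the Galois group of the splitting field of $T(x,y)$, seen as a polynomial in $x$ over $\mathbf{Q}(y)$, over $\mathbf{Q}(y)$, regarded as a permutation group on the roots. *)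

(* Defs.v *)
From HB Require Import structures.
From mathcomp Require Import all_boot all_order all_algebra all_fingroup all_solvable all_field.
From Stdlib Require Import Classical_Prop.
Set Implicit Arguments.
Unset Strict Implicit.
Unset Printing Implicit Defensive.
Import GRing.Theory.
Local Open Scope ring_scope.

Notation Qy := {fraction {poly rat}}.

(* The outer variable is x, the coefficients are polynomials in y. *)
Definition tutteU (a b : nat) : {poly {poly rat}} :=
  \sum_(0 <= i < a.+1) ('X - 1) ^+ (a - i) *+ 'C(b, i)
  + (\sum_(a.+1 <= j < b.+1) ('X - 1) ^+ (j - a) *+ 'C(b, j))%:P.

Definition tutteUQy (a b : nat) : {poly Qy} :=
  map_poly (@tofrac {poly rat}) (tutteU a b).

(* The Tutte polynomial of a matroid given by its bases, as a corank-nullity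
   sum; tutte_uniform below recovers tutteU from it. *)
Section MatroidTutte.
Variables (E : finType) (bases : {set {set E}}).
Definition matroid_rank (A : {set E}) : nat :=
  (\max_(B : {set E} | B \in bases) #|A :&: B|)%N.
Definition tutte : {poly {poly rat}} :=
  \sum_(A : {set E}) ('X - 1) ^+ (matroid_rank setT - matroid_rank A)
     * (('X - 1) ^+ (#|A| - matroid_rank A))%:P.
End MatroidTutte.

Definition uniform_bases (a b : nat) : {set {set 'I_b}} :=
  [set B : {set 'I_b} | #|B| == a].

Lemma uniform_rank a b (A : {set 'I_b}) : (a <= b)%N ->
  matroid_rank (uniform_bases a b) A = minn #|A| a.
Proof.
move=> ab; apply/eqP; rewrite eqn_leq; apply/andP; split.
  apply/bigmax_leqP => B; rewrite inE => /eqP <-.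
  by rewrite leq_min !subset_leq_card ?subsetIl ?subsetIr.
have [B] : exists B : {set 'I_b}, #|B| == a /\ (minn #|A| a <= #|A :&: B|)%N.
  have [aA|/ltnW Aa] := leqP a #|A|.
    have: (0 < #|[set B : {set 'I_b} | B \subset A & #|B| == a]|)%N.
      by rewrite cards_draws bin_gt0.
    case/card_gt0P=> B; rewrite inE => /andP[sBA /eqP cB]; exists B.
    split; first exact/eqP.
    by rewrite (setIidPr sBA) cB.
  have: (0 < #|[set B : {set 'I_b} | B \subset ~: A & #|B| == (a - #|A|)%N]|)%N.
    by rewrite cards_draws bin_gt0 [#|~: A|]cardsCs setCK card_ord leq_sub2r.
  case/card_gt0P=> B; rewrite inE => /andP[sBA /eqP cB]; exists (A :|: B).
  split; last by rewrite (setIidPl _) ?subsetUl.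
  rewrite cardsU cB.
  have -> : A :&: B = set0.
    by apply/eqP; rewrite setI_eq0 disjoint_sym disjoints_subset.
  by rewrite cards0 subn0 subnKC.
case=> cB le; apply: leq_trans le _.
by apply: (bigmax_sup B); rewrite ?inE.
Qed.

Lemma tutte_uniform a b : (a <= b)%N -> tutte (uniform_bases a b) = tutteU a b.
Proof.
move=> ab; rewrite /tutte /tutteU.
under eq_bigr => A _ do rewrite !uniform_rank // cardsT card_ord (minn_idPr ab).
pose F k : {poly {poly rat}} :=
  ('X - 1) ^+ (a - minn k a) * (('X - 1) ^+ (k - minn k a))%:P.
have -> : \sum_(A : {set 'I_b}) ('X - 1) ^+ (a - minn #|A| a)
     * (('X - 1) ^+ (#|A| - minn #|A| a))%:P = \sum_(A : {set 'I_b}) F #|A| by [].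
rewrite (partition_big (fun A : {set 'I_b} => inord #|A| : 'I_b.+1) predT) //=.
transitivity (\sum_(k < b.+1) F k *+ 'C(b, k)).
  apply: eq_bigr => k _.
  have cA (A : {set 'I_b}) : (#|A| <= b)%N.
    by rewrite -[leqRHS]card_ord max_card.
  rewrite (eq_bigr (fun=> F k)) => [|A /eqP <-]; last by rewrite inordK // ltnS.
  rewrite sumr_const; congr (_ *+ _).
  have -> : 'C(b, k) = #|[set A : {set 'I_b} | #|A| == k]|.
    by rewrite card_draws card_ord.
  apply: eq_card => A; rewrite [RHS]inE.
  by rewrite -[LHS]/(\val (inord #|A| : 'I_b.+1) == k) /= inordK // ltnS.
rewrite -(big_mkord xpredT (fun k => F k *+ 'C(b, k))).
rewrite (@big_cat_nat _ _ _ a.+1) //=; congr (_ + _).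
  apply: eq_big_nat => i; rewrite ltnS /= => ia.
  by rewrite /F (minn_idPl ia) subnn expr0 mulr1.
rewrite rmorph_sum; apply: eq_big_nat => i /andP[/ltnW ai _].
by rewrite /F (minn_idPr ai) subnn expr0 mul1r rmorphMn.
Qed.

(* A splitting field of p over F, with a list of the roots of p in it. The list
   may contain repetitions: only membership in it matters below. Existence is
   splitting_ext_exists at the end of this file. *)
Record splitting_ext (F : fieldType) (p : {poly F}) := SplittingExt {
  spl_field :> splittingFieldType F;
  spl_roots : seq spl_field;
  spl_factor : map_poly (in_alg spl_field) p %= \prod_(r <- spl_roots) ('X - r%:P);
  spl_gen : <<1 & spl_roots>>%VS = fullv }.

Section GaloisPerm.
Variables (F : fieldType) (p : {poly F}) (L : splitting_ext p).

Local Notation roots_type := (seq_sub (spl_roots L)).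

Lemma gal_root_mem (g : gal_of {:L}) (r : roots_type) :
  g (val r) \in spl_roots L.
Proof.
have rE x : (x \in spl_roots L) = root (map_poly (in_alg L) p) x.
  by rewrite (eqp_root (spl_factor L)) root_prod_XsubC.
rewrite rE -[map_poly _ _](_ : map_poly g (map_poly (in_alg L) p) = _).
  by rewrite fmorph_root -rE (valP r).
rewrite -map_poly_comp; apply: eq_map_poly => k /=.
by rewrite linearZ rmorph1.
Qed.

Definition gal_root_fun (r : roots_type) (g : gal_of {:L}) : roots_type :=
  SeqSub (gal_root_mem g r).

Fact gal_root_is_action : is_action setT gal_root_fun.
Proof.
split=> [g r s /(congr1 val) /= /fmorph_inj /val_inj //|r g h _ _].
by apply: val_inj => /=; rewrite galM ?memvf.
Qed.

Canonical gal_root_action := Action gal_root_is_action.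

(* The Galois group of p over F, as a group of permutations of the roots. *)
Definition galPerm : {group {perm roots_type}} :=
  (actperm gal_root_action @* 'Gal({:L} / 1))%G.
End GaloisPerm.

Lemma irredp_dvdp_exists (F : fieldType) (p : {poly F}) :
  (1 < size p)%N -> exists2 r, r %| p & irreducible_poly r.
Proof.
have [n] := ubnP (size p); elim: n p => // n IHn p; rewrite ltnS => len C'p.
have [irr|] := classic (irreducible_poly p); first by exists p.
move=> nirr.
have [q [C'q q_dv_p neq]] : exists q : {poly F}, [/\ size q != 1, q %| p & ~~ (q %= p)].
  apply: NNPP => nex; apply: nirr; split=> // q C'q q_dv_p.
  by apply/idPn => neq; apply: nex; exists q.
have nz_p : p != 0 by rewrite -size_poly_gt0 ltnW.
have lt_qp : (size q < size p)%N.
  by rewrite ltn_neqAle dvdp_leq // andbT dvdp_size_eqp.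
have [||r r_dv_q irr_r] := IHn q.
- exact: leq_trans lt_qp len.
- by rewrite ltn_neqAle eq_sym C'q size_poly_gt0 (dvdpN0 q_dv_p).
by exists r => //; apply: dvdp_trans r_dv_q q_dv_p.
Qed.

Local Definition map_poly_extField (F : fieldType) (L : fieldExtType F) :=
  map_poly (in_alg L) : {poly F} -> {poly L}.

Local Notation "p ^%:A" := (map_poly_extField _ p)
  (at level 2, format "p ^%:A") : ring_scope.

(* The library's FinSplittingFieldFor, with F no longer assumed finite. *)
Lemma splitting_ext_exists (F : fieldType) (p : {poly F}) :
  p != 0 -> inhabited (splitting_ext p).
Proof.
have mapXsubC (R S : nzRingType) (f : {rmorphism R -> S}) x:
    map_poly f ('X - x%:P) = 'X - (f x)%:P.
  by rewrite rmorphB /= map_polyX map_polyC.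
move=> nz_p.
pose splits (L : fieldType) (q : {poly L}) :=
  exists zs : seq L, q %= \prod_(z <- zs) ('X - z%:P).
suffices [L [zs [Dp defL]]] : exists (L : fieldExtType F) (zs : seq L),
    p^%:A %= \prod_(z <- zs) ('X - z%:P) /\ <<1 & zs>>%VS = fullv.
  have axL : SplittingField.axiom L.
    exists p^%:A; last by exists zs.
    by apply/polyOverP=> i; rewrite coef_map memvZ ?mem1v.
  pose mL := FieldExt_isSplittingField.Build F L axL.
  pose sL : splittingFieldType F := HB.pack L mL.
  exact: (inhabits (@SplittingExt F p sL zs Dp defL)).
suffices [L [ys Dp]]: exists L : fieldExtType F, splits L p^%:A.
  pose Lp := subvs_of <<1 & ys>>; pose toL := linfun (vsval : Lp -> L).
  have [zs Dys]: {zs | map toL zs = ys}.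
    exists (map (vsproj _) ys); rewrite -map_comp map_id_in // => y ys_y.
    by rewrite /= lfunE /= vsprojK ?seqv_sub_adjoin.
  exists Lp, zs; split.
    set lhs := (lhs in lhs %= _); set rhs := (rhs in _ %= rhs).
    suffices: map_poly toL lhs %= map_poly toL rhs by rewrite eqp_map.
    rewrite -Dys big_map in Dp; apply: etrans Dp; apply: congr2.
      by rewrite -map_poly_comp; apply/eq_map_poly=> x; apply: rmorph_alg.
    by rewrite rmorph_prod; apply/eq_bigr=> z _; apply: mapXsubC.
  set Lzs := LHS; pose Lys := (toL @: Lzs)%VS; apply/vspaceP=> u.
  have: val u \in Lys by rewrite /Lys aimg_adjoin_seq aimg1 Dys (valP u).
  by case/memv_imgP=> v Lzs_v; rewrite memvf lfunE => /val_inj->.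
move: {2}_.+1 (ltnSn (size p)) => n; elim: n => // n IHn in F p nz_p * => lbn.
have [Cp|C'p] := leqP (size p) 1.
  exists F^o, [::].
  by rewrite big_nil -size_poly_eq1 size_map_poly eqn_leq Cp size_poly_gt0.
have [r r_dv_p irr_r] := irredp_dvdp_exists C'p.
have{irr_r} [K _ [x rx0 defK]] := irredp_FAdjoin irr_r.
have{r rx0 r_dv_p} /factor_theorem/sig_eqW[q Dp]: root p^%:A x.
  by rewrite -(divpK r_dv_p) [_^%:A]rmorphM rootM rx0 orbT.
have Dszp: size p = size (q * ('X - x%:P)) by rewrite -Dp size_map_poly.
have nz_q: q != 0.
  by move: nz_p; rewrite -size_poly_eq0 Dszp size_poly_eq0 mulf_eq0 => /norP[].
have [L [zs Dq]]: exists L : fieldExtType K, splits L q^%:A.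
  apply: (IHn K q nz_q).
  by rewrite ltnS Dszp size_mul ?polyXsubC_eq0 ?size_XsubC ?addn2 in lbn.
suffices: splits L p^%:A^%:A.
  rewrite -[_^%:A]map_poly_comp.
  rewrite -(eq_map_poly (fun a : F => baseField_scaleE a 1)).
  by exists (baseFieldType L).
exists (x%:A :: zs); rewrite big_cons; set rhs := _ * _.
by rewrite Dp mulrC [_^%:A]rmorphM /= mapXsubC /= eqp_mull.
Qed.

(* Main.v *)
(* Put U(x) and V(y) for the two summands of the Tutte polynomial, of degrees a
   and b - a. Both are Morse (simple critical points, distinct critical values),
   because the truncated binomial A(X) = sum_{i <= a} C(b, i) X^(a-i) satisfies
   X(X+1)A' = (aX - (b-a))A + (b-a)C(b,a): at a critical point z this gives
   (az - (b-a))A(z) = -(b-a)C(b,a), so A(z) <> 0 determines z, and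
   differentiating once more excludes A''(z) = 0. The proof shows that the group
   is the full symmetric group whenever U and V are Morse and deg V > deg U,
   i.e. as soon as b > 2a; this covers both parts of the theorem.

   Call a pair of roots rigid if the transposition exchanging them is not in the
   group G. The product W of the differences x_i - x_j over rigid pairs lies in
   Q[y]. If y0 were a simple zero of W, then sqrt(W) would force a nontrivial
   inertia element at y0; the only two roots colliding at y0 being a rigid pair,
   that element is their transposition, a contradiction. So every zero of W is
   multiple. As W divides the discriminant prod_k (V(y) + U(z_k)) (z_k the
   critical points of U), whose zeros are at most double and whose double zeros
   are critical points of V with value -U(z_k), deg W <= 2(a-1). On the other
   hand each x_i - x_j grows like |y|^(deg V / a), so that
   a deg W >= deg V * #{rigid pairs}. If G is not symmetric, there are at least
   2(a-1) rigid ordered pairs since "equal or exchanged by a transposition of G"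
   is an equivalence relation, whence deg V <= a. *)

Require Import Defs.
From HB Require Import structures.
From mathcomp Require Import all_boot all_order all_algebra all_fingroup all_solvable all_field.
From mathcomp Require Import ring zify.
From Stdlib Require Import Classical_Prop.
Set Implicit Arguments.
Unset Strict Implicit.
Unset Printing Implicit Defensive.
Import GRing.Theory.
Local Open Scope ring_scope.
Import Order.TTheory Num.Theory.

(** * Morse polynomials and truncated binomials *)

Definition morse (F : fieldType) (p : {poly F}) : Prop :=
  (forall z, root p^`() z -> ~~ root p^`()^`() z) /\
  (forall z w, root p^`() z -> root p^`() w -> p.[z] = p.[w] -> z = w).

Lemma morse_addC (F : fieldType) (p : {poly F}) (c : F) :
  morse (p + c%:P) -> morse p.
Proof.
rewrite /morse derivD derivC addr0 => -[simple inj]; split=> // z w pz pw e.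
by apply: (inj z w pz pw); rewrite !hornerD e !hornerC.
Qed.

Lemma morse_translate (F : fieldType) (p : {poly F}) (c : F) :
  morse p -> morse (p \Po ('X - c%:P)).
Proof.
move=> [simple inj].
have dcomp q : (q \Po ('X - c%:P))^`() = q^`() \Po ('X - c%:P) :> {poly F}.
  by rewrite deriv_comp derivXsubC mulr1.
have ev q z : (q \Po ('X - c%:P)).[z] = q.[z - c] :> F.
  by rewrite horner_comp hornerXsubC.
split=> [z|z w]; rewrite !dcomp /root !ev; first exact: simple.
by move=> pz pw e; apply: (addIr (- c)); apply: inj.
Qed.

(** X^a times the truncation of (1 + 1/X)^b after the term X^(-a), so a monic polynomial of degree
    a. *)
Definition binom_trunc (R : nzRingType) (a b : nat) : {poly R} :=
  \poly_(k < a.+1) 'C(b, a - k)%:R.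

Lemma size_binom_trunc (R : nzRingType) a b : size (binom_trunc R a b) = a.+1.
Proof. by rewrite size_poly_eq // subnn bin0 oner_neq0. Qed.

Lemma map_binom_trunc (R S : nzRingType) (f : {rmorphism R -> S}) a b :
  map_poly f (binom_trunc R a b) = binom_trunc S a b.
Proof.
apply/polyP => k; rewrite coef_map !coef_poly.
by case: (k < a.+1)%N; [exact: rmorph_nat | exact: raddf0].
Qed.

(** Comparing coefficients, each positive degree gives an instance of m C(b, m) = (b - m + 1) C(b, m
    - 1); the truncation shows only in the constant term. *)
Lemma binom_trunc_ode (R : comNzRingType) a b : (a <= b)%N ->
  ('X^2 + 'X) * (binom_trunc R a b)^`() =
    (a%:R *: 'X - (b - a)%:R%:P) * binom_trunc R a b
    + ((b - a)%:R * 'C(b, a)%:R)%:P.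
Proof.
move=> ab; set A := binom_trunc R a b.
have cA k : A`_k = if (k <= a)%N then 'C(b, a - k)%:R else 0 by rewrite coef_poly ltnS.
apply/polyP => -[|n].
  rewrite mulrDl mulrBl !coefD coefN -scalerAl coefZ !coefXM coefXnM coefCM coefC.
  by rewrite cA /= subn0 mulr0 !add0r addNr.
rewrite mulrDl mulrBl !coefD coefN -scalerAl coefZ !coefXM coefXnM coefCM coefC /= addr0 coef_deriv.
have -> : (if (n.+1 < 2)%N then 0 else A`_(n.+1 - 2).+1 *+ (n.+1 - 2).+1) = A`_n *+ n.
  by case: n => [|n]; rewrite ?mulr0n // subn2.
rewrite coef_deriv !cA !mulr_natl.
have [na|] := ltnP n a; last first.
  rewrite leq_eqVlt => /predU1P[->|an]; first by rewrite leqnn mul0rn addr0 mul0rn subr0.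
  by rewrite leqNgt an /= !mul0rn addr0 subr0.
rewrite (ltnW na) -!mulrnA; apply/eqP; rewrite eq_sym subr_eq -!mulrnDr; apply/eqP.
congr (_%:R).
have := mul_bin_left b (a - n.+1); rewrite subnSK // => e.
have {e}: ((a - n) * 'C(b, a - n) = (b - a + n.+1) * 'C(b, a - n.+1))%N.
  by rewrite e subnBA // addnBAC.
move: (subnKC (ltnW na)); set m := (a - n)%N => <- e.
rewrite -addnA -mulnDr [(n.+1 + _)%N]addnC mulnDr.
by congr (_ + _)%N; rewrite mulnC e mulnC.
Qed.

Lemma morse_binom_trunc (F : numFieldType) a b :
  (0 < a < b)%N -> morse (binom_trunc F a b).
Proof.
case/andP=> a_gt0 ab; have := binom_trunc_ode F (ltnW ab).
set A := binom_trunc F a b; set c : F := (b - a)%:R * 'C(b, a)%:R => ode.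
have c0 : c != 0 by rewrite mulf_neq0 // pnatr_eq0 -lt0n ?subn_gt0 ?bin_gt0 // ltnW.
have crit z : root A^`() z -> (a%:R * z - (b - a)%:R) * A.[z] = - c.
  move=> /rootP Az; have := congr1 (horner^~ z) ode.
  rewrite /= hornerM Az mulr0 hornerD hornerM !hornerE => /esym/eqP.
  by rewrite addr_eq0 => /eqP.
split=> [z Az|z w Az Aw e].
  (* Where A' and A'' both vanish, the differentiated identity leaves a A(z) = 0. *)
  apply/negP => Azz; have := congr1 (fun q : {poly F} => q^`().[z]) ode.
  rewrite /= derivM hornerD !hornerM (rootP Az) (rootP Azz) !mulr0 add0r.
  rewrite derivD derivC addr0 derivM hornerD !hornerM (rootP Az) mulr0 addr0.
  rewrite derivB derivC derivZ derivX !hornerE => /esym/eqP.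
  have := crit z Az; case: (eqVneq A.[z] 0) => [-> /eqP|Az0 _].
    by rewrite mulr0 eq_sym oppr_eq0 (negPf c0).
  by rewrite subr0 mulf_eq0 (negPf Az0) orbF pnatr_eq0 eqn0Ngt a_gt0.
have A0 : A.[w] != 0.
  by apply/eqP=> A0; move/eqP: (crit w Aw); rewrite A0 mulr0 eq_sym oppr_eq0 (negPf c0).
have := crit z Az; rewrite e -(crit w Aw) => /(mulIf A0)/addIr/mulfI; apply.
by rewrite pnatr_eq0 -lt0n.
Qed.
(** * Places *)

Lemma natr_nonroot (F : numFieldType) (p : {poly F}) :
  p != 0 -> exists n : nat, ~~ root p n%:R.
Proof.
move=> p0; apply: NNPP => allr.
have rp n : root p n%:R by apply/negPn/negP => nr; apply: allr; exists n.
suff: (size [seq n%:R : F | n <- iota 0 (size p)] < size p)%N.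
  by rewrite size_map size_iota ltnn.
apply: max_poly_roots => //; first by apply/allP => _ /mapP[n _ ->].
by rewrite map_inj_uniq ?iota_uniq //; apply: mulrIn; rewrite oner_neq0.
Qed.

(** Monic polynomials keep their degree under f, so the Sylvester matrix keeps its shape. *)
Lemma resultant_map_monic (R S : comNzRingType) (f : {rmorphism R -> S})
    (p q : {poly R}) :
  p \is monic -> q \is monic ->
  f (resultant p q) = resultant (map_poly f p) (map_poly f q).
Proof.
move=> mp mq; rewrite /resultant /Sylvester_mx.
rewrite !size_map_poly_id0 ?(monicP mp) ?(monicP mq) ?rmorph1 ?oner_neq0 //.
rewrite -det_map_mx /= map_col_mx; congr (\det (col_mx _ _));
  by apply: map_lin1_mx => v; rewrite map_poly_rV rmorphM /= map_rVpoly.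
Qed.

(* Adding a multiple of the monic polynomial m makes p monic, so that its
   resultant with m commutes with i and f; it vanishes under i, hence under f,
   and m and p get a common root. *)
Lemma place_extension (R : comNzRingType) (K : fieldType) (C : numClosedFieldType)
    (i : {rmorphism R -> K}) (f : {rmorphism R -> C}) (x : K) :
    (forall r, i r = 0 -> f r = 0) -> integralOver i x ->
  exists z, forall p, root (map_poly i p) x -> root (map_poly f p) z.
Proof.
move=> kif [m mm mx]; apply: NNPP => noz.
have [rs rsE] := closed_field_poly_normal (map_poly f m).
have [p px prs] : exists2 p, root (map_poly i p) x &
    forall z, z \in rs -> ~~ root (map_poly f p) z.
  elim: rs {rsE} => [|z s [p px ps]]; first by exists 0; rewrite ?rmorph0 ?root0.
  have [q qx qz] : exists2 q, root (map_poly i q) x & ~~ root (map_poly f q) z.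
    apply: NNPP => H; apply: noz; exists z => q qx; apply/negPn/negP => qz.
    by apply: H; exists q.
  (* At n, [lin w] is the value at w of the image of n p + q. It is a nonzero polynomial, since p
     does not vanish at the points of s nor q at z; hence some natural number n works for all w at
     once. *)
  pose lin w := (map_poly f p).[w] *: 'X + (map_poly f q).[w]%:P.
  have lin0 w : w \in z :: s -> lin w != 0.
    move=> ws; apply/eqP=> l0.
    have := congr1 (coefp 0) l0; have := congr1 (coefp 1) l0.
    rewrite /coefp /= !coefD !coefZ !coefX !coefC ?coef0 /= mulr1 mulr0 addr0 add0r.
    move=> pw qw; move: ws; rewrite inE => /predU1P[wz|ws].
      by move: qz; rewrite /root -wz qw eqxx.
    by move: (ps w ws); rewrite /root pw eqxx.
  have /natr_nonroot[n nn] : \prod_(w <- z :: s) lin w != 0.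
    by rewrite prodf_seq_neq0; apply/allP => w /lin0.
  exists (p *+ n + q).
    by rewrite rmorphD rmorphMn /root hornerD hornerMn (rootP px) (rootP qx) mul0rn addr0.
  move=> w ws; apply: contra nn; rewrite /root rmorphD rmorphMn hornerD hornerMn => e.
  rewrite horner_prod prodf_seq_eq0; apply/hasP; exists w => //=.
  by rewrite !hornerE mulr_natr.
have sm : (1 < size m)%N.
  rewrite ltnNge; apply/negP => /size1_polyC mC; move: mm mx.
  by rewrite mC monicE lead_coefC => /eqP ->; rewrite rmorph1 /root hornerC oner_eq0.
pose q := m * 'X^(size p) + p.
have spq : (size p < size (m * 'X^(size p))%R)%N.
  by rewrite size_mulXn ?monic_neq0 // -[X in (X < _)%N]addn0 ltn_add2l ltnW.
have mq : q \is monic by rewrite monicE lead_coefDl // lead_coef_monicM ?lead_coefXn.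
have sq : (1 < size q)%N.
  by rewrite size_polyDl // size_mulXn ?monic_neq0 // ltn_addl.
have [[u v] /= _ e] := resultant_in_ideal sm sq.
have : i (resultant m q) = 0.
  have := congr1 (fun r => (map_poly i r).[x]) e.
  rewrite /q map_polyC hornerC rmorphD !rmorphM rmorphD rmorphM !hornerE.
  by rewrite (rootP mx) (rootP px) !(mulr0, mul0r, addr0).
move/kif/eqP; rewrite resultant_map_monic // resultant_eq0.
suff: coprimep (map_poly f m) (map_poly f q) by rewrite /coprimep => /eqP ->.
apply: Pdiv.ClosedField.root_coprimep => z mz.
rewrite rmorphD rmorphM !hornerE (rootP mz) mul0r add0r.
apply: prs; move: mz; rewrite rsE rootZ ?root_prod_XsubC //.
by rewrite lead_coef_eq0 monic_neq0 ?monic_map.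
Qed.
(** The x t are adjoined one at a time, passing from R to {poly R} with the variable sent to x t in
    K and to z in C; the conclusion of [place_extension] is the kernel condition needed for the next
    step. *)
Lemma place_extension_fin (R0 : comNzRingType) (K : fieldType)
    (C : numClosedFieldType) (i0 : {rmorphism R0 -> K}) (f0 : {rmorphism R0 -> C})
    (T : finType) (x : T -> K) :
    (forall u, i0 u = 0 -> f0 u = 0) -> (forall t, integralOver i0 (x t)) ->
  exists (R : comNzRingType) (j : {rmorphism R0 -> R}) (i : {rmorphism R -> K})
    (f : {rmorphism R -> C}) (r : T -> R),
    [/\ i \o j =1 i0, f \o j =1 f0, forall u, i u = 0 -> f u = 0
      & forall t, i (r t) = x t].
Proof.
move=> kif0 intx.
suff [R [j [i [f [ij fj kif imx]]]]] : exists (R : comNzRingType)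
    (j : {rmorphism R0 -> R}) (i : {rmorphism R -> K}) (f : {rmorphism R -> C}),
    [/\ i \o j =1 i0, f \o j =1 f0, forall u, i u = 0 -> f u = 0
      & forall t, t \in enum T -> exists u, i u = x t].
  have /fin_all_exists[r ir] t : exists u, i u = x t by apply: imx; rewrite mem_enum.
  by exists R, j, i, f, r.
elim: (enum T) => [|t s [R [j [i [f [ij fj kif imx]]]]]].
  by exists R0, idfun, i0, f0.
have [|z fz] := place_extension kif (x := x t).
  have [m mm mx] := intx t; exists (map_poly j m); first exact: monic_map.
  by rewrite -map_poly_comp (eq_map_poly ij).
pose ci : commr_rmorph i (x t) := fun _ => mulrC _ _.
pose cf : commr_rmorph f z := fun _ => mulrC _ _.
exists {poly R}, (polyC \o j), (horner_morph ci), (horner_morph cf).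
split=> [u|u|p /eqP|t'].
- by rewrite /= horner_morphC -ij.
- by rewrite /= horner_morphC -fj.
- by move/fz/eqP.
rewrite inE => /predU1P[->|/imx[u iu]]; last by exists u%:P; rewrite /= horner_morphC.
by exists 'X; rewrite /= horner_morphX.
Qed.

(** * Degrees, fractions and integral closedness of F[y] *)

Lemma size_deriv_num (R : numDomainType) (p : {poly R}) : size p^`() = (size p).-1.
Proof.
have [p1|] := leqP (size p) 1.
  by rewrite [p]size1_polyC // derivC size_poly0 size_polyC; case: (_ != 0).
case sp: (size p) => [//|[//|n]] _ /=.
have p0 : p != 0 by rewrite -size_poly_gt0 sp.
apply/eqP; rewrite eqn_leq -ltnS -{1}sp lt_size_deriv //= ltnNge.
apply/negP => /leq_sizeP/(_ n (leqnn n))/eqP; rewrite coef_deriv mulrn_eq0 /=.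
by move: p0; rewrite -lead_coef_eq0 lead_coefE sp /= => /negPf ->.
Qed.

Lemma seq_sub_lift (E : eqType) (s s' : seq E) :
  {subset s' <= s} -> exists ts : seq (seq_sub s), map val ts = s'.
Proof.
elim: s' => [|x s' IHs] sub; first by exists [::].
have [|ts <-] := IHs; first by move=> z zs; apply: sub; rewrite inE zs orbT.
by exists (SeqSub (sub x (mem_head _ _)) :: ts).
Qed.

Lemma fractionP (R : idomainType) (u : {fraction R}) :
  exists n d : R, d != 0 /\ u * tofrac d = tofrac n.
Proof.
elim/generic_quotient.quotW: u => x; exists \n_x, \d_x; split; first exact: denom_ratioP.
unlock tofrac; rewrite -[LHS]FracField.pi_mul; apply/eqP.
by rewrite FracField.equivf_def !numden_Ratio ?oner_neq0 ?mulr1 ?denom_ratioP // mulrC.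
Qed.

(** The rational root argument: for u = n/d in lowest terms, clearing denominators in a monic
    equation of degree k gives d | n^k, so d is constant. *)
Lemma integral_fracpoly (F : fieldType) (u : {fraction {poly F}}) :
  integralOver (@tofrac {poly F}) u -> exists q, u = tofrac q.
Proof.
move=> [m mm mu].
have [n [d [d0 cop ud]]] : exists n d : {poly F},
    [/\ d != 0, coprimep d n & u * tofrac d = tofrac n].
  have [n [d [d0 ud]]] := fractionP u.
  have g0 : gcdp d n != 0 by rewrite gcdp_eq0 negb_and d0.
  exists (n %/ gcdp d n), (d %/ gcdp d n); split.
  - by apply: contraNneq d0 => e; rewrite -(divpK (dvdp_gcdl d n)) e mul0r.
  - by rewrite coprimep_div_gcd ?d0.
  have g0F : tofrac (gcdp d n) != 0 by rewrite tofrac_eq0.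
  by apply: (mulIf g0F); rewrite -mulrA -!tofracM !divpK ?dvdp_gcdl ?dvdp_gcdr.
have [k mk] : exists k, size m = k.+1.
  by exists (size m).-1; rewrite prednK // size_poly_gt0 monic_neq0.
have mk1 : m`_k = 1 by have := monicP mm; rewrite lead_coefE mk.
have sum0 : \sum_(i < k.+1) m`_i * n ^+ i * d ^+ (k - i) = 0.
  apply/eqP; rewrite -tofrac_eq0 rmorph_sum /=; apply/eqP.
  transitivity (tofrac d ^+ k * (map_poly (@tofrac {poly F}) m).[u]).
    rewrite horner_coef size_map_inj_poly ?rmorph0 //; last first.
      by move=> p q /eqP; rewrite tofrac_eq => /eqP.
    rewrite mk mulr_sumr; apply: eq_bigr => i _.
    rewrite coef_map /= !tofracM !tofracXn -ud exprMn.
    have -> : tofrac d ^+ k = tofrac d ^+ (k - i) * tofrac d ^+ i.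
      by rewrite -exprD subnK // -ltnS.
    ring.
  by rewrite (rootP mu) mulr0.
have dn : d %| n ^+ k.
  move: sum0; rewrite big_ord_recr /= mk1 mul1r subnn mulr1 => /eqP.
  rewrite addrC addr_eq0 => /eqP ->; rewrite dvdpNr.
  apply: (big_ind (fun p => d %| p)) => [|p q dp dq|i _]; first exact: dvdp0.
    exact: dvdp_add.
  by rewrite dvdp_mull // -(prednK (_ : 0 < k - i)%N) ?subn_gt0 // exprS dvdp_mulr.
have : size d == 1.
  by rewrite -coprimepp; apply: coprimep_dvdl dn _; rewrite coprimep_expr.
move/size_poly1P=> [c c0 dc].
exists (n * c^-1%:P); rewrite tofracM -ud dc -mulrA -tofracM -polyCM mulfV //.
by rewrite tofrac1 mulr1.
Qed.

(** * Multiple roots and products of differences *)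

Lemma deriv_prod_XsubC_root (R : comNzRingType) (I : finType) (x : I -> R) i :
  (\prod_j ('X - (x j)%:P))^`().[x i] = \prod_(j | j != i) (x i - x j).
Proof.
rewrite (bigD1 i) //= derivM derivXsubC mul1r hornerD hornerM hornerXsubC subrr.
by rewrite mul0r addr0 horner_prod; under eq_bigr do rewrite hornerXsubC.
Qed.

Lemma deriv_XsubC_exp_mul (R : comNzRingType) (z : R) n (r : {poly R}) :
  (('X - z%:P) ^+ n.+1 * r)^`()
  = ('X - z%:P) ^+ n * (r *+ n.+1 + ('X - z%:P) * r^`()).
Proof.
rewrite derivM deriv_exp derivXsubC mul1r /= mulrDr mulrnAr mulrnAl.
by rewrite mulrA -exprSr.
Qed.

Lemma root_deriv2_triple (R : comNzRingType) (z : R) (r : {poly R}) :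
  root (('X - z%:P) ^+ 3 * r)^`()^`() z.
Proof.
by rewrite !deriv_XsubC_exp_mul /root expr1 hornerM hornerXsubC subrr mul0r.
Qed.

(** Every repeated root of p + c is a critical point of p with value -c, so there is only one; a
    third index at it would make p'' vanish there too. *)
Lemma morse_double_root (F : fieldType) (I : finType) (x : I -> F) (p : {poly F}) (c : F)
    (i j k l : I) :
    morse p -> p + c%:P = \prod_i ('X - (x i)%:P) ->
  i != j -> x i = x j -> k != l -> x k = x l -> k \in [set i; j].
Proof.
move=> [simple inj] pE ij xij kl xkl.
have dpE : (\prod_i ('X - (x i)%:P))^`() = p^`() by rewrite -pE derivD derivC addr0.
have dbl m n : m != n -> x m = x n -> root p^`() (x m).
  move=> mn xmn; rewrite -dpE /root deriv_prod_XsubC_root (bigD1 n) 1?eq_sym //=.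
  by rewrite xmn subrr mul0r.
have pc m : p.[x m] = - c.
  apply/eqP; rewrite -addr_eq0; have := congr1 (horner^~ (x m)) pE.
  rewrite /= hornerD hornerC => ->; rewrite horner_prod; apply/eqP.
  by rewrite (bigD1 m) //= hornerXsubC subrr mul0r.
have xik : x i = x k by apply: inj; rewrite ?(dbl i j) ?(dbl k l) ?pc.
rewrite !inE; apply/negPn/negP; rewrite negb_or => /andP[ki kj].
have /negP := simple _ (dbl _ _ ij xij); apply.
rewrite -dpE (bigD1 i) //= (bigD1 j) 1?eq_sym //= (bigD1 k) ?ki ?kj //= -xij -xik.
set r := \prod_(_ | _) _; have := root_deriv2_triple (x i) r.
by rewrite !exprS expr0 mulr1 -!mulrA.
Qed.

(** A point moved by s has the same x-value as its image, so s is supported on {i, j}. *)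
Lemma tperm_of_double_root (T : finType) (R : eqType) (x : T -> R) (s : {perm T}) i j :
    i != j -> s != 1%g -> (forall t, x (s t) = x t) ->
    (forall k l, k != l -> x k = x l -> k \in [set i; j]) ->
  s = tperm i j.
Proof.
move=> ij s1 xs dbl; have s_on : perm_on [set i; j] s.
  apply/subsetP => k; rewrite inE => sk.
  by apply: (dbl k (s k)); rewrite ?xs // eq_sym.
have sij k : k \in [set i; j] -> s k \in [set i; j] by rewrite perm_closed.
have si : s i = j.
  have := sij i; rewrite set21 !inE => /(_ isT) /orP[]/eqP // si.
  have := sij j; rewrite set22 !inE => /(_ isT) /orP[]/eqP sj.
    by move: ij; rewrite -(inj_eq (@perm_inj _ s)) si sj eqxx.
  case/eqP: s1; apply/permP => k; rewrite perm1.
  have [|/(out_perm s_on)//] := boolP (k \in [set i; j]).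
  by rewrite !inE => /orP[]/eqP ->.
have sj : s j = i.
  have := sij j; rewrite set22 !inE => /(_ isT) /orP[]/eqP // sj.
  by move: ij; rewrite -(inj_eq (@perm_inj _ s)) si sj eqxx.
apply/permP => k; case: tpermP => [->|->|/eqP ki /eqP kj] //.
by rewrite (out_perm s_on) // !inE negb_or ki kj.
Qed.

(** Pairing (t, u) with (u, t) gives a square up to sign; [enum_rank] merely selects one order of
    each pair. *)
Lemma prod_diff_sym (R : comNzRingType) (T : finType) (x : T -> R) (e : pred (T * T)) :
    (forall t u, e (t, u) = e (u, t)) -> (forall t, ~~ e (t, t)) ->
    let half p := e p && (enum_rank p.1 < enum_rank p.2)%N in
  \prod_(p | e p) (x p.1 - x p.2)
  = (-1) ^+ #|half| * (\prod_(p | half p) (x p.1 - x p.2)) ^+ 2.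
Proof.
move=> e_sym e_irr half.
rewrite (bigID (fun p : T * T => enum_rank p.1 < enum_rank p.2)%N) /=.
rewrite expr2 mulrCA; congr (_ * _).
pose sw (p : T * T) := (p.2, p.1).
have swK : involutive sw by case.
rewrite (reindex_inj (inv_inj swK)) /= -prodr_const -big_split /=.
apply: eq_big => [[t u]|[t u] _] /=; last by rewrite mulN1r opprB.
change (e (u, t) && ~~ (enum_rank u < enum_rank t)%N
  = e (t, u) && (enum_rank t < enum_rank u)%N).
rewrite e_sym; have [<-|tu] := eqVneq t u; first by rewrite (negPf (e_irr t)).
congr (_ && _); rewrite -leqNgt leq_eqVlt; case: eqVneq => //.
by move=> /val_inj/enum_rank_inj tu'; rewrite tu' eqxx in tu.
Qed.

(* Dedekind's independence of characters, on the free monoid over T. *)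
Lemma character_independence (F : fieldType) (G : finType) (T : eqType) (A : {pred G})
    (c : G -> F) (v : G -> T -> F) (g1 : G) :
    g1 \in A -> c g1 != 0 ->
    (forall l : seq T, \sum_(g in A) c g * \prod_(t <- l) v g t = 0) ->
  exists g, [/\ g \in A, g != g1 & v g =1 v g1].
Proof.
move=> Ag1 c1 sum0; apply: NNPP => distinct.
(* The relation survives multiplication by factors v g t - k with k constant. Choosing, for each g
   other than g1, a factor that vanishes at g but not at g1 isolates the term of g1. *)
have sum0' (ps : seq (T * F)) l :
    \sum_(g in A) c g * ((\prod_(t <- l) v g t) * \prod_(p <- ps) (v g p.1 - p.2)) = 0.
  elim: ps l => [|p ps IHps] l.
    by rewrite -[RHS](sum0 l); apply: eq_bigr => g _; rewrite big_nil mulr1.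
  transitivity (\sum_(g in A) c g * ((\prod_(t <- p.1 :: l) v g t) *
      \prod_(p <- ps) (v g p.1 - p.2)) - p.2 * \sum_(g in A) c g *
      ((\prod_(t <- l) v g t) * \prod_(p <- ps) (v g p.1 - p.2))); last first.
    by rewrite !IHps mulr0 subr0.
  rewrite mulr_sumr -sumrB; apply: eq_bigr => g _.
  by rewrite !big_cons; ring.
have [ps [ps1 psA]] : exists ps : seq (T * F),
    \prod_(p <- ps) (v g1 p.1 - p.2) != 0 /\
    forall g, g \in A -> g != g1 -> \prod_(p <- ps) (v g p.1 - p.2) = 0.
  suff [ps [ps1 psA]] : exists ps : seq (T * F),
      \prod_(p <- ps) (v g1 p.1 - p.2) != 0 /\ forall g, g \in enum A -> g != g1 ->
      \prod_(p <- ps) (v g p.1 - p.2) = 0.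
    by exists ps; split=> // g Ag; apply: psA; rewrite mem_enum.
  have: {subset enum A <= A} by move=> g; rewrite mem_enum.
  elim: (enum A) => [|g s IHs] sA; first by exists [::]; rewrite big_nil oner_neq0.
  have [|ps [ps1 psA]] := IHs; first by move=> h hs; apply: sA; rewrite inE hs orbT.
  have [->|gg1] := eqVneq g g1.
    exists ps; split=> // h; rewrite inE => /predU1P[->|]; first by rewrite eqxx.
    exact: psA.
  have [t vt] : exists t, v g1 t != v g t.
    apply: NNPP => vg; apply: distinct; exists g; split=> //; first by rewrite sA ?mem_head.
    by move=> t; apply/eqP/negPn/negP => vt; apply: vg; exists t; rewrite eq_sym.
  exists ((t, v g t) :: ps); split; first by rewrite big_cons mulf_neq0 // subr_eq0.
  move=> h; rewrite inE big_cons => /predU1P[->|hs hg1]; first by rewrite subrr mul0r.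
  by rewrite psA // mulr0.
have := sum0' ps [::]; rewrite (bigD1 g1) //= [X in _ + X]big1; last first.
  by move=> g /andP[Ag gg1]; rewrite psA // !mulr0.
by rewrite big_nil mul1r addr0 => /eqP; apply/negP; rewrite mulf_neq0.
Qed.

(** * Growth of polynomials, degrees and lists of roots *)

Lemma exprD_le (F : numDomainType) (x y : F) n :
  0 <= x -> 0 <= y -> (x + y) ^+ n <= 2 ^+ n * (x ^+ n + y ^+ n).
Proof.
move=> x0 y0; rewrite mulrDr -!exprMn.
have [xy|/ltW yx] := real_leP (ger0_real x0) (ger0_real y0).
  rewrite (@le_trans _ _ ((2 * y) ^+ n)) //; last by rewrite lerDr exprn_ge0 ?mulr_ge0.
  by rewrite lerXn2r ?nnegrE ?addr_ge0 ?mulr_ge0 // mulr_natl mulr2n lerD2r.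
rewrite (@le_trans _ _ ((2 * x) ^+ n)) //; last by rewrite lerDl exprn_ge0 ?mulr_ge0.
by rewrite lerXn2r ?nnegrE ?addr_ge0 ?mulr_ge0 // mulr_natl mulr2n lerD2l.
Qed.

(** Once |x| is at least twice |z| for every root z, each |x - z| is at least |x| / 2; smaller x are
    absorbed into the constant. *)
Lemma le_exprn_poly (F : numClosedFieldType) (p : {poly F}) : p != 0 ->
  exists2 C : F, 0 <= C & forall x, `|x| ^+ (size p).-1 <= C * (1 + `|p.[x]|).
Proof.
have [rs pE] := closed_field_poly_normal p; set c := lead_coef p in pE.
rewrite -lead_coef_eq0 -/c => c0; have nc0 : 0 < `|c| by rewrite normr_gt0.
have -> : (size p).-1 = size rs by rewrite pE size_scale // size_prod_XsubC.
pose K := \sum_(z <- rs) 2 * `|z|; set d := size rs.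
have K0 : 0 <= K by apply: sumr_ge0 => z _; rewrite mulr_ge0.
have leK z : z \in rs -> 2 * `|z| <= K.
  move=> zrs; rewrite /K (perm_big _ (perm_to_rem zrs)) big_cons lerDl.
  by apply: sumr_ge0 => w _; rewrite mulr_ge0.
have C0 : 0 <= 2 ^+ d / `|c| by rewrite divr_ge0 ?exprn_ge0 ?ler0n // ltW.
exists (K ^+ d + 2 ^+ d / `|c|) => [|x]; first by rewrite addr_ge0 ?exprn_ge0.
have [xK|/ltW Kx] := real_leP (normr_real x) (ger0_real K0).
  apply: (@le_trans _ _ (K ^+ d)); first by rewrite lerXn2r ?nnegrE.
  rewrite mulrDr mulr1 -addrA lerDl addr_ge0 // mulr_ge0 // addr_ge0 // exprn_ge0 //.
apply: (@le_trans _ _ (2 ^+ d / `|c| * `|p.[x]|)); last first.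
  by rewrite ler_pM // ?mulr_ge0 // ?lerDr ?exprn_ge0 // lerDr.
rewrite pE hornerZ normrM mulrA divfK ?gt_eqF // horner_prod normr_prod.
have far z : z \in rs -> `|x| <= 2 * `|('X - z%:P).[x]|.
  move=> /leK zK; rewrite hornerXsubC.
  apply: (@le_trans _ _ (2 * (`|x| - `|z|))); last by rewrite ler_pM2l ?lerB_dist.
  rewrite mulrBr lerBrDl [leRHS]mulr_natl [leRHS]mulr2n lerD2r.
  exact: le_trans zK Kx.
rewrite /d; elim: rs far {K K0 Kx C0 pE leK d} => [|z s IHs] far.
  by rewrite big_nil !expr0 mulr1.
rewrite big_cons /= !exprS mulrACA ler_pM ?exprn_ge0 //; first by rewrite far ?mem_head.
by apply: IHs => w ws; apply: far; rewrite inE ws orbT.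
Qed.

Lemma horner_nat_le (F : numDomainType) (p : {poly F}) :
  exists2 C : F, 0 <= C & forall n : nat, (0 < n)%N ->
    `|p.[n%:R]| <= C * n%:R ^+ (size p).-1.
Proof.
exists (\sum_(i < size p) `|p`_i|) => [|n n0]; first exact: sumr_ge0.
rewrite horner_coef mulr_suml (le_trans (ler_norm_sum _ _ _)) // ler_sum // => i _.
rewrite normrM normrX normr_nat ler_wpM2l // ler_weXn2l ?ler1n //.
by rewrite -ltnS (ltn_predK (ltn_ord i)).
Qed.

Lemma expn_degree_le (F : archiNumDomainType) (C : F) (d e : nat) :
  (forall n : nat, (0 < n)%N -> n%:R ^+ d <= C * n%:R ^+ e) -> (d <= e)%N.
Proof.
move=> le_pow; rewrite leqNgt; apply/negP => ed.
have C0 : 0 <= C by have := le_pow 1%N isT; rewrite !expr1n mulr1; apply: le_trans.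
pose n := (Num.bound C).+1; have n0 : 0 < n%:R :> F by rewrite ltr0n.
have : n%:R <= C.
  rewrite -(ler_pM2r (exprn_gt0 e n0)) (le_trans _ (le_pow n isT)) // -exprS.
  by rewrite ler_weXn2l ?ler1n.
apply/negP; rewrite -real_ltNge ?ger0_real ?ler0n //.
by rewrite (lt_trans (archi_boundP C0)) // ltr_nat.
Qed.

Lemma eq_poly_nat (F : numFieldType) (p q : {poly F}) :
  (forall n : nat, p.[n%:R] = q.[n%:R]) -> p = q.
Proof.
move=> e; apply/eqP; rewrite -subr_eq0; apply/negPn/negP => /natr_nonroot[n].
by rewrite /root hornerD hornerN e subrr eqxx.
Qed.

Lemma size_le_double_undup (T : eqType) (s : seq T) :
  (forall x, count_mem x s <= 2)%N -> (size s <= 2 * size (undup s))%N.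
Proof.
move=> le2; rewrite -(perm_size (perm_count_undup s)) size_flatten /shape -map_comp.
elim: (undup s) => [//|x u IHu] /=; rewrite size_nseq mulnS leq_add //.
Qed.

Lemma uniq_simple_roots (F : idomainType) (p : {poly F}) (c : F) (s : seq F) :
    p = c *: \prod_(z <- s) ('X - z%:P) ->
  (forall z, root p z -> ~~ root p^`() z) -> uniq s.
Proof.
move=> pE simple; apply/(tuple_uniqP (in_tuple s)) => i j e.
apply/eqP/negPn/negP => ij; set z := tnth (in_tuple s) i in e.
have pz : root p z.
  by rewrite pE /root hornerZ mulf_eq0 -[_.[z] == 0]/(root _ z) root_prod_XsubC mem_tnth orbT.
have /negP := simple z pz; apply.
rewrite pE big_tnth derivZ /root hornerZ (deriv_prod_XsubC_root (tnth (in_tuple s))).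
by rewrite (bigD1 j) 1?eq_sym //= -/z e subrr mul0r mulr0.
Qed.

(** Both sides equal the product of the p'(x_i): factoring p' over its roots and exchanging the two
    products turns it into values of p. *)
Lemma prod_root_diff (F : fieldType) (I : finType) (x : I -> F) (c : F) (crit : seq F)
    (p : {poly F}) :
    p = \prod_(i : I) ('X - (x i)%:P) -> p^`() = c *: \prod_(z <- crit) ('X - z%:P) ->
  \prod_i \prod_(j | j != i) (x i - x j)
  = (c * (-1) ^+ size crit) ^+ #|I| * \prod_(z <- crit) p.[z].
Proof.
move=> pE dpE.
transitivity (\prod_i (c * (-1) ^+ size crit * \prod_(z <- crit) (z - x i))).
  apply: eq_bigr => i _; rewrite -deriv_prod_XsubC_root -pE dpE hornerZ.
  rewrite horner_prod -mulrA; congr (_ * _).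
  elim: crit {dpE} => [|z s IHs]; first by rewrite !big_nil mulr1.
  by rewrite !big_cons IHs hornerXsubC exprS -opprB !mulNr mul1r mulrCA.
rewrite big_split /= prodr_const exchange_big /=; congr (_ * _).
apply: eq_bigr => z _; rewrite pE horner_prod.
by apply: eq_bigr => i _; rewrite hornerXsubC.
Qed.

(** * The Galois group of U(x) + V(y) over Q(y) *)

Section SumOfPolynomials.

Variables U V : {poly rat}.

Let UV : {poly {poly rat}} := map_poly polyC U + V%:P.

Definition sumQy : {poly Qy} := map_poly (@tofrac {poly rat}) UV.

Let a := (size U).-1.
Let UC : {poly algC} := map_poly ratr U.
Let VC : {poly algC} := map_poly ratr V.

Hypotheses (monicU : U \is monic) (sizeU : (1 < size U)%N)
  (sizeV : (size U < size V)%N) (morseU : morse UC) (morseV : morse VC).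

Variable L : splitting_ext sumQy.

Local Notation T := (seq_sub (spl_roots L)).

Let yL : {rmorphism {poly rat} -> L} := in_alg L \o (@tofrac {poly rat}).

Let yL_inj : injective yL.
Proof. by move=> p q /fmorph_inj/eqP; rewrite tofrac_eq => /eqP. Qed.

Let size_UV : size UV = size U.
Proof.
have sU : size (map_poly (@polyC rat) U) = size U by rewrite size_map_inj_poly // => ? ? /polyC_inj.
by rewrite size_polyDl sU // (leq_ltn_trans (size_polyC_leq1 _)).
Qed.

Let monicUV : UV \is monic.
Proof.
have sU : size (map_poly (@polyC rat) U) = size U by rewrite size_map_inj_poly // => ? ? /polyC_inj.
rewrite monicE lead_coefDl ?sU ?(leq_ltn_trans (size_polyC_leq1 _)) //.
by rewrite -monicE monic_map.
Qed.

Let UV_factor : map_poly yL UV = \prod_(x <- spl_roots L) ('X - x%:P).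
Proof.
apply/eqP; rewrite -eqp_monic ?monic_map ?monic_prod_XsubC //.
by rewrite map_poly_comp; exact: spl_factor.
Qed.

(* A place of L above y = y0, defined on a ring containing the roots. The ring
   is only mapped to L; sp_ker makes sp_ev a function of the image. *)
Record specialization (y0 : algC) := Specialization {
  sp_ring : comNzRingType;
  sp_base : {rmorphism {poly rat} -> sp_ring};
  sp_emb : {rmorphism sp_ring -> L};
  sp_ev : {rmorphism sp_ring -> algC};
  sp_root : T -> sp_ring;
  sp_embE : forall q, sp_emb (sp_base q) = yL q;
  sp_evE : forall q, sp_ev (sp_base q) = (map_poly ratr q).[y0];
  sp_ker : forall u, sp_emb u = 0 -> sp_ev u = 0;
  sp_rootE : forall t, sp_emb (sp_root t) = val t }.

Let specialize y0 : inhabited (specialization y0).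
Proof.
pose c0 : commr_rmorph (@ratr algC) y0 := fun _ => mulrC _ _.
have [|t|R [j [i [f [r [ij fj kif ir]]]]]] :=
  @place_extension_fin _ _ _ yL (horner_morph c0) T val.
- by move=> u /eqP; rewrite fmorph_eq0 tofrac_eq0 => /eqP ->; rewrite rmorph0.
- exists UV => //; rewrite UV_factor root_prod_XsubC; exact: valP.
exact: inhabits (Specialization ij fj kif ir).
Qed.
Let ev y0 (S : specialization y0) (t : T) : algC := sp_ev S (sp_root S t).

(** The factorisation holds coefficientwise in L and is carried to [algC] by [sp_ker]. The list [ts]
    may still repeat roots, as their distinctness is deduced from this. *)
Let ev_factor_seq y0 (S : specialization y0) (ts : seq T) :
  map val ts = spl_roots L ->
  \prod_(t <- ts) ('X - (ev S t)%:P) = UC + (VC.[y0])%:P.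
Proof.
move=> tsE; pose P := \prod_(t <- ts) ('X - (sp_root S t)%:P).
have mapP (A : comNzRingType) (g : {rmorphism sp_ring S -> A}) :
    map_poly g P = \prod_(t <- ts) ('X - (g (sp_root S t))%:P).
  by rewrite rmorph_prod; apply: eq_bigr => t _; rewrite rmorphB /= map_polyX map_polyC.
have embP : map_poly (sp_emb S) P = map_poly yL UV.
  rewrite mapP UV_factor; transitivity (\prod_(x <- map val ts) ('X - x%:P)).
    by rewrite big_map; apply: eq_bigr => t _; rewrite sp_rootE.
  by rewrite tsE.
rewrite -mapP; transitivity (map_poly (sp_ev S \o sp_base S) UV).
  apply/polyP => k; rewrite !coef_map /=; apply/eqP; rewrite -subr_eq0 -rmorphB.
  apply/eqP/sp_ker; rewrite rmorphB sp_embE.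
  by move: (congr1 (coefp k) embP); rewrite /coefp !coef_map /= => ->; rewrite subrr.
rewrite /UV rmorphD /= map_polyC /= sp_evE; congr (_ + _).
rewrite -map_poly_comp; apply: eq_map_poly => c.
by rewrite /= sp_evE map_polyC hornerC.
Qed.

(** * The discriminant in x *)

Let crit : seq algC := sval (closed_field_poly_normal UC^`()).
Let lcU : algC := lead_coef UC^`().

Let critE : UC^`() = lcU *: \prod_(z <- crit) ('X - z%:P).
Proof. exact: svalP (closed_field_poly_normal _). Qed.

Let sizeUC : size UC = size U. Proof. exact: size_map_poly. Qed.
Let sizeVC : size VC = size V. Proof. exact: size_map_poly. Qed.

Let size_crit : size crit = a.-1.
Proof.
have lc0 : lcU != 0.
  by rewrite lead_coef_eq0 -size_poly_gt0 size_deriv_num sizeUC -subn1 subn_gt0.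
have := congr1 (fun p : {poly algC} => size p) critE.
rewrite size_scale // size_prod_XsubC size_deriv_num sizeUC /= -/a => e.
by rewrite e.
Qed.

(** Normalised so that its value at y0 is exactly the product of all ordered differences of the
    specialised roots. *)
Let disc : {poly algC} :=
  (lcU * (-1) ^+ size crit) ^+ a *: \prod_(z <- crit) (VC + (UC.[z])%:P).

Let size_VCD c : size (VC + c%:P) = size V.
Proof.
by rewrite size_polyDl sizeVC // (leq_ltn_trans (size_polyC_leq1 _)) // (ltn_trans sizeU).
Qed.

Let disc_neq0 : disc != 0.
Proof.
rewrite scaler_eq0 negb_or expf_neq0 /=.
  rewrite prodf_seq_neq0; apply/allP => z _ /=.
  by rewrite -size_poly_gt0 size_VCD (leq_ltn_trans _ sizeV).
rewrite mulf_neq0 ?expf_neq0 ?oppr_eq0 ?oner_neq0 //.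
by rewrite lead_coef_eq0 -size_poly_gt0 size_deriv_num sizeUC -subn1 subn_gt0.
Qed.

Let size_disc : (size disc).-1 = (a.-1 * (size V).-1)%N.
Proof.
rewrite size_scale; last by move: disc_neq0; rewrite scaler_eq0 negb_or => /andP[].
rewrite size_prod_seq; last first.
  by move=> z _; rewrite -size_poly_gt0 size_VCD (leq_ltn_trans _ sizeV).
rewrite (eq_bigr (fun=> size V)) => [|z _]; last exact: size_VCD.
rewrite big_const_seq count_predT iter_addn_0 size_crit mulnC subSn.
  by rewrite -{2}[a.-1]muln1 -mulnBr subn1.
by rewrite leq_pmulr // (leq_ltn_trans _ sizeV).
Qed.

Let disc_horner y0 (I : finType) (x : I -> algC) :
  UC + (VC.[y0])%:P = \prod_i ('X - (x i)%:P) ->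
  #|I| = a -> disc.[y0] = \prod_i \prod_(j | j != i) (x i - x j).
Proof.
move=> pE cardI; rewrite (prod_root_diff pE (c := lcU) (crit := crit)).
  rewrite cardI /disc hornerZ horner_prod; congr (_ * _); apply: eq_bigr => z _.
  by rewrite !hornerD !hornerC addrC.
by rewrite derivD derivC addr0 critE.
Qed.

(** A repetition would persist under specialisation at an integer where the discriminant is
    nonzero. *)
Let uniq_roots : uniq (spl_roots L).
Proof.
have [ts tsE] := seq_sub_lift (fun z (zs : z \in spl_roots L) => zs).
have [n n_ndisc] := natr_nonroot disc_neq0.
have [S] := specialize n%:R.
have evE := ev_factor_seq S tsE.
rewrite -tsE map_inj_uniq; last exact: val_inj.
have sts : #|'I_(size ts)| = a.
  rewrite card_ord -(size_map val ts) tsE /a -size_UV.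
  by rewrite -(size_map_inj_poly yL_inj (rmorph0 _)) UV_factor size_prod_XsubC.
apply/(tuple_uniqP (in_tuple ts)) => i j e; apply/eqP/negPn/negP => nij.
move: n_ndisc; rewrite /root (disc_horner (x := fun i => ev S (tnth (in_tuple ts) i)) _ sts).
  rewrite (bigD1 i) //= (bigD1 j) 1?eq_sym //= e subrr !mul0r eqxx //.
by rewrite -evE big_tnth.
Qed.

Let cardT : #|{: T}| = a.
Proof.
rewrite card_seq_sub // /a -size_UV.
by rewrite -(size_map_inj_poly yL_inj (rmorph0 _)) UV_factor size_prod_XsubC.
Qed.

Let ev_factor y0 (S : specialization y0) :
  UC + (VC.[y0])%:P = \prod_t ('X - (ev S t)%:P).
Proof.
have [ts tsE] := seq_sub_lift (fun z (zs : z \in spl_roots L) => zs).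
rewrite -(ev_factor_seq S tsE); apply: perm_big; apply: uniq_perm; rewrite ?index_enum_uniq //.
  by rewrite -(map_inj_uniq val_inj) tsE.
move=> t; rewrite mem_index_enum -(mem_map val_inj) tsE; exact: valP.
Qed.

(** * Galois action and descent to Q[y] *)

Let galoisL : galois 1 {:L}.
Proof.
rewrite /galois sub1v normalFieldf andbT /=.
apply/separableP => x _; apply: pcharf0_separable; apply/pcharf0P => n.
rewrite -(rmorph_nat yL) -(rmorph0 yL) (inj_eq yL_inj).
by rewrite -polyC_natr polyC_eq0 pnatr_eq0.
Qed.

(** An invariant element lies in Q(y), and Q[y] is integrally closed. *)
Let descend (u : L) :
    (forall g, g \in 'Gal({:L} / 1)%g -> g u = u) -> integralOver yL u ->
  exists q, yL q = u.
Proof.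
move=> fix_u [m mm mu].
have : u \in 1%VS.
  rewrite -[1%VS](galois_fixedField galoisL); apply/fixedFieldP; first exact: memvf.
  exact: fix_u.
case/vlineP=> k uk; have [|q kq] := @integral_fracpoly _ k.
  exists m => //; rewrite -(fmorph_root (in_alg L)) -map_poly_comp.
  by move: mu; rewrite uk.
by exists q; rewrite uk kq.
Qed.

Let gal_perm (g : gal_of {:L}) : {perm T} := actperm (gal_root_action L) g.

Let gal_permE g (t : T) : val (gal_perm g t) = g (val t).
Proof. by rewrite actpermE. Qed.

Let mem_galPerm s :
  reflect (exists2 g, g \in 'Gal({:L} / 1)%g & s = gal_perm g) (s \in galPerm L).
Proof.
by apply: (iffP morphimP) => [[g _ ? ->]|[g ? ->]]; exists g; rewrite ?inE.
Qed.

Let root_integral (t : T) : integralOver yL (val t).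
Proof. exists UV => //; rewrite UV_factor root_prod_XsubC; exact: valP. Qed.

Let integral_prod (I : Type) (s : seq I) (P : pred I) (F : I -> L) :
  (forall i, P i -> integralOver yL (F i)) -> integralOver yL (\prod_(i <- s | P i) F i).
Proof. by move=> iF; elim/big_ind: _ => //; [exact: integral1 | exact: integral_mul]. Qed.

Let integral_sum (I : Type) (s : seq I) (P : pred I) (F : I -> L) :
  (forall i, P i -> integralOver yL (F i)) -> integralOver yL (\sum_(i <- s | P i) F i).
Proof. by move=> iF; elim/big_ind: _ => //; [exact: integral0 | exact: integral_add]. Qed.

Let diff_prod (e : pred (T * T)) : L := \prod_(p | e p) (val p.1 - val p.2).

Let diff_prod_descends (e : pred (T * T)) :
    (forall s, s \in galPerm L -> forall t u, e (s t, s u) = e (t, u)) ->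
  exists q, yL q = diff_prod e.
Proof.
move=> e_stable; apply: descend => [g gG|]; last first.
  by apply: integral_prod => p _; apply: integral_sub; exact: root_integral.
rewrite rmorph_prod /=.
pose s := gal_perm g; pose sp (p : T * T) := (s p.1, s p.2).
have spK : bijective sp.
  by exists (fun p => (s^-1 p.1, s^-1 p.2)%g) => -[t u]; rewrite /sp /= ?permK ?permKV.
rewrite /diff_prod [RHS](reindex sp) /=; last exact: onW_bij.
apply: eq_big => [[t u]|[t u] _] /=; first by rewrite e_stable //; apply/mem_galPerm; exists g.
by rewrite rmorphB /s !gal_permE.
Qed.

Let diff_prod_ev (e : pred (T * T)) q y0 (S : specialization y0) :
  yL q = diff_prod e ->
  (map_poly ratr q).[y0] = \prod_(p | e p) (ev S p.1 - ev S p.2).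
Proof.
move=> qE; rewrite -(sp_evE S).
transitivity (sp_ev S (\prod_(p | e p) (sp_root S p.1 - sp_root S p.2))); last first.
  by rewrite rmorph_prod; apply: eq_bigr => p _; rewrite rmorphB.
apply/eqP; rewrite -subr_eq0 -rmorphB; apply/eqP/sp_ker.
rewrite rmorphB sp_embE qE rmorph_prod /diff_prod; apply/eqP; rewrite subr_eq0; apply/eqP.
by apply: eq_bigr => p _; rewrite rmorphB /= !sp_rootE.
Qed.

Let gal_perm_faithful g : g \in 'Gal({:L} / 1)%g -> gal_perm g = 1%g -> g = 1%g.
Proof.
move=> gG g1; apply/eqP/gal_eqP => u _; rewrite gal_id.
have /subvP sub : (<<1 & spl_roots L>> <= fixedField [set g])%VS.
  apply/Fadjoin_seqP; split=> [|x xr]; first exact: sub1v.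
  apply/fixedFieldP; first exact: memvf.
  move=> _ /set1P->; have := gal_permE g (SeqSub xr).
  by rewrite g1 perm1.
have /sub/mem_fixedFieldP[_ ->] // : u \in <<1 & spl_roots L>>%VS by rewrite spl_gen memvf.
exact: set11.
Qed.

(** * Rigid pairs and ramification *)

Let swappable p := (p.1 != p.2) && (tperm p.1 p.2 \in galPerm L).
Let rigid p := (p.1 != p.2) && (tperm p.1 p.2 \notin galPerm L).

Let tperm_galPerm s (t u : T) :
  s \in galPerm L -> (tperm (s t) (s u) \in galPerm L) = (tperm t u \in galPerm L).
Proof. by move=> sG; rewrite -tpermJ groupJr. Qed.

Let rigid_stable s : s \in galPerm L -> forall t u, rigid (s t, s u) = rigid (t, u).
Proof. by move=> sG t u; rewrite /rigid /= (inj_eq perm_inj) tperm_galPerm. Qed.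

Let swappable_stable s :
  s \in galPerm L -> forall t u, swappable (s t, s u) = swappable (t, u).
Proof. by move=> sG t u; rewrite /swappable /= (inj_eq perm_inj) tperm_galPerm. Qed.

(** The inertia element is found without valuations. If the zero is simple, the sums over the Galois
    group of specialised monomials in the roots, weighted by the sign with which g acts on [delta],
    all vanish; independence of characters then gives some g other than 1 with the same specialised
    roots as 1. *)
Let rigid_multiple_root q y0 :
    yL q = diff_prod rigid -> q != 0 -> root (map_poly (@ratr algC) q) y0 ->
  root (map_poly (@ratr algC) q)^`() y0.
Proof.
move=> qE q0 qy0; apply/negPn/negP => simple.
have [S] := specialize y0.
pose half p := rigid p && (enum_rank p.1 < enum_rank p.2)%N.
have half_sq (R : comNzRingType) (x : T -> R) :
    \prod_(p | rigid p) (x p.1 - x p.2)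
    = (-1) ^+ #|half| * (\prod_(p | half p) (x p.1 - x p.2)) ^+ 2.
  apply: prod_diff_sym => [t u|t]; last by rewrite /rigid eqxx.
  by rewrite /rigid eq_sym tpermC.
pose delta : L := \prod_(p | half p) (val p.1 - val p.2).
have deltaE : yL q = (-1) ^+ #|half| * delta ^+ 2 by rewrite qE -half_sq.
pose deltaS := \prod_(p | half p) (sp_root S p.1 - sp_root S p.2).
have emb_deltaS : sp_emb S deltaS = delta.
  by rewrite rmorph_prod; apply: eq_bigr => p _; rewrite rmorphB /= !sp_rootE.
have ev_deltaS : sp_ev S deltaS = 0.
  have : (-1) ^+ #|half| * (sp_ev S deltaS) ^+ 2 = 0.
    rewrite -[RHS](rootP qy0) (diff_prod_ev S qE) (half_sq _ (ev S)).
    by congr (_ * _ ^+ 2); rewrite rmorph_prod; apply: eq_bigr => p _; rewrite rmorphB.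
  by move/eqP; rewrite mulrI_eq0 ?sqrf_eq0; [move/eqP | apply/mulfI; rewrite signr_eq0].
have int_delta : integralOver yL delta.
  by apply: integral_prod => p _; apply: integral_sub; exact: root_integral.
pose odd_gal (g : gal_of {:L}) := g delta != delta.
have galMul (g : gal_of {:L}) (u w : L) : g (u * w) = g u * g w by exact: rmorphM.
have gal_delta g : g \in 'Gal({:L} / 1)%g -> g delta = (-1) ^+ odd_gal g * delta.
  move=> gG; rewrite /odd_gal; have [->|] := eqVneq (g delta) delta; first by rewrite mul1r.
  rewrite expr1 mulN1r => nd; have : (g delta) ^+ 2 == delta ^+ 2.
    apply/eqP/(@mulfI _ ((-1) ^+ #|half|)); rewrite ?signr_eq0 // -deltaE.
    transitivity (g ((-1) ^+ #|half| * delta ^+ 2)); first by rewrite rmorphM rmorph_sign rmorphXn.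
    by rewrite -deltaE /= linearZ rmorph1.
  by rewrite eqf_sqr (negPf nd) /= => /eqP.
have sum0 (l : seq T) : \sum_(g in 'Gal({:L} / 1)%g) (-1) ^+ odd_gal g *
    \prod_(t <- l) ev S (gal_perm g t) = 0.
  pose SL : L := \sum_(g in 'Gal({:L} / 1)%g) (-1) ^+ odd_gal g *
    \prod_(t <- l) val (gal_perm g t).
  pose SS := \sum_(g in 'Gal({:L} / 1)%g) (-1) ^+ odd_gal g *
    \prod_(t <- l) sp_root S (gal_perm g t).
  have embSS : sp_emb S SS = SL.
    rewrite rmorph_sum; apply: eq_bigr => g _; rewrite rmorphM rmorph_sign rmorph_prod.
    by congr (_ * _); apply: eq_bigr => t _; rewrite sp_rootE.
  have -> : \sum_(g in 'Gal({:L} / 1)%g) (-1) ^+ odd_gal g *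
      \prod_(t <- l) ev S (gal_perm g t) = sp_ev S SS.
    by rewrite rmorph_sum; apply: eq_bigr => g _; rewrite rmorphM rmorph_sign rmorph_prod.
  (* Traces of multiples of delta are polynomials vanishing at y0. As q has only a
     simple zero there, dividing by delta leaves a multiple of delta. *)
  have [qN qNE] : exists qN, yL qN = SL * delta.
    have -> : SL * delta = galTrace 1 {:L} ((\prod_(t <- l) val t) * delta).
      rewrite /galTrace mulr_suml; apply: eq_bigr => g gG.
      rewrite [RHS]galMul (gal_delta g gG) rmorph_prod mulrCA -mulrA; congr (_ * (_ * _)).
      by apply: eq_bigr => t _; rewrite gal_permE.
    apply: descend => [g gG|].
      have := galTrace_fixedField 1 (memvf ((\prod_(t <- l) val t) * delta : L)).
      by case/mem_fixedFieldP=> _ /(_ _ gG).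
    apply: integral_sum => g gG; rewrite [X in integralOver _ X]galMul (gal_delta g gG) rmorph_prod.
    apply: integral_mul.
      by apply: integral_prod => t _; have := root_integral (gal_perm g t); rewrite gal_permE.
    apply: integral_mul => //; rewrite -(rmorph_sign yL); exact: integral_id.
  have qNy0 : root (map_poly (@ratr algC) qN) y0.
    rewrite /root -(sp_evE S) -[qN in sp_base _ qN]/qN.
    have /sp_ker/eqP : sp_emb S (sp_base S qN - SS * deltaS) = 0.
      by rewrite rmorphB sp_embE rmorphM embSS emb_deltaS qNE subrr.
    by rewrite rmorphB rmorphM ev_deltaS mulr0 subr0.
  (* Here [h] replaces y - y0, which need not be rational: it vanishes at y0, and simplicity of the
     zero keeps its cofactor [E] nonzero there. *)
  pose h := gcdp q qN; have h0 : h != 0 by rewrite gcdp_eq0 negb_and q0.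
  have hy0 : root (map_poly (@ratr algC) h) y0 by rewrite gcdp_map root_gcd qy0.
  pose E := q %/ h; pose c := qN %/ h.
  have qEh : q = E * h by rewrite divpK ?dvdp_gcdl.
  have qNch : qN = c * h by rewrite divpK ?dvdp_gcdr.
  have Ey0 : ~~ root (map_poly (@ratr algC) E) y0.
    apply: contra simple => Ey0; rewrite qEh rmorphM derivM /root hornerD !hornerM.
    by rewrite (rootP Ey0) (rootP hy0) mul0r mulr0 addr0.
  have : sp_emb S (sp_base S E * SS * (-1) ^+ #|half|) = sp_emb S (sp_base S c * deltaS).
    rewrite !rmorphM rmorph_sign !sp_embE embSS emb_deltaS.
    have hL0 : yL h * delta != 0.
      rewrite mulf_neq0 // ?(raddf_eq0 _ yL_inj) //.
      by apply: contraNneq q0 => d0; apply/eqP/yL_inj;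
        rewrite [LHS]deltaE d0 expr0n mulr0 rmorph0.
    apply: (mulIf hL0).
    have sgn_q : yL q * (-1) ^+ #|half| = delta ^+ 2 by rewrite deltaE mulrC signrMK.
    transitivity (yL (E * h) * (-1) ^+ #|half| * (SL * delta)).
      have permute (e u s z d : L) : e * u * s * (z * d) = e * z * s * (u * d).
        by rewrite !mulrA; congr (_ * _); rewrite mulrAC [e * u * z]mulrAC mulrAC.
      by rewrite rmorphM permute.
    by rewrite -qEh sgn_q -qNE qNch rmorphM expr2 mulrC mulrACA.
  move/eqP; rewrite -subr_eq0 -rmorphB => /eqP/sp_ker/eqP.
  rewrite rmorphB !rmorphM ev_deltaS mulr0 subr0 sp_evE rmorph_sign.
  by rewrite mulf_eq0 signr_eq0 orbF mulf_eq0 -/(root _ _) (negPf Ey0) => /eqP.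
have c1 : (-1) ^+ odd_gal 1%g != 0 :> algC by rewrite signr_eq0.
have [g [gG g1 evg]] := character_independence (group1 _) c1 sum0.
have sgE t : ev S (gal_perm g t) = ev S t.
  by rewrite evg; congr (ev S _); apply: val_inj; rewrite gal_permE gal_id.
have [p rp /eqP] : exists2 p, rigid p & ev S p.1 - ev S p.2 == 0.
  have /eqP := rootP qy0; rewrite (diff_prod_ev S qE) prodf_seq_eq0 => /hasP[p _ /andP[]].
  by exists p.
move/eqP; rewrite subr_eq0 => /eqP pE; case/andP: (rp) => p12 /negP; apply.
rewrite -(@tperm_of_double_root _ _ (ev S) (gal_perm g) p.1 p.2) //.
- by apply/mem_galPerm; exists g.
- by apply: contraNneq g1 => /gal_perm_faithful->.
by move=> k l; apply: morse_double_root morseU (ev_factor S) p12 pE.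
Qed.

(** * Zeros of the discriminant and degree bounds *)

Let uniq_crit : uniq crit.
Proof. by apply: uniq_simple_roots critE _; case: morseU. Qed.

Let mem_crit z : (z \in crit) = root UC^`() z.
Proof.
rewrite critE rootZ ?root_prod_XsubC // lead_coef_eq0 -size_poly_gt0.
by rewrite size_deriv_num sizeUC -subn1 subn_gt0.
Qed.

(** The critical values of U are distinct, so where V + U(z) vanishes no other factor does. *)
Let disc_factor z : z \in crit ->
  exists r, disc = r * (VC + (UC.[z])%:P) /\
    forall y, VC.[y] = - UC.[z] -> r.[y] != 0.
Proof.
move=> zc; exists ((lcU * (-1) ^+ size crit) ^+ a *:
  \prod_(w <- crit | w != z) (VC + (UC.[w])%:P)); split.
  by rewrite /disc (bigD1_seq z) //= -scalerAl; congr (_ *: _); rewrite mulrC.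
move=> y Vy; have : (lcU * (-1) ^+ size crit) ^+ a != 0.
  by move: disc_neq0; rewrite scaler_eq0 negb_or => /andP[].
move=> c0; rewrite hornerZ mulf_neq0 // horner_prod big_seq_cond prodf_seq_neq0.
apply/allP => w wc; apply/implyP => /andP[_ wz].
rewrite hornerD hornerC Vy addrC subr_eq0; apply: contraNneq wz => e.
by apply/eqP; case: morseU => _; apply; rewrite -?mem_crit.
Qed.

Let disc_root y : root disc y -> exists2 z, z \in crit & VC.[y] = - UC.[z].
Proof.
rewrite /root hornerZ mulf_eq0 => /orP[c0|].
  by move: disc_neq0; rewrite scaler_eq0 c0.
rewrite horner_prod prodf_seq_eq0 => /hasP[z zc /= e].
by exists z => //; move: e; rewrite hornerD hornerC addr_eq0 => /eqP.
Qed.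

Let disc_double_root y : root disc y -> root disc^`() y -> root VC^`() y.
Proof.
move=> /disc_root[z zc Vy]; have [r [-> /(_ y Vy) r0]] := disc_factor zc.
rewrite /root derivM hornerD !hornerM hornerD hornerC Vy addNr mulr0 add0r.
by rewrite derivD derivC addr0 mulf_eq0 (negPf r0).
Qed.

Let disc_no_triple_root y p : disc != ('X - y%:P) ^+ 3 * p.
Proof.
apply/eqP => discE.
have [d0 d1] : root disc y /\ root disc^`() y.
  have ev0 n r : root (('X - y%:P) ^+ n.+1 * r) y.
    by rewrite rootM exprS rootM root_XsubC eqxx.
  by rewrite discE deriv_XsubC_exp_mul !ev0.
have d2 : root disc^`()^`() y by rewrite discE root_deriv2_triple.
have Vd := disc_double_root d0 d1; case: morseV => simple _; have /negP := simple y Vd; apply.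
have [z zc Vy] := disc_root d0; have [r [E /(_ y Vy) r0]] := disc_factor zc.
have dE : disc^`() = r^`() * (VC + (UC.[z])%:P) + r * VC^`().
  by rewrite E derivM derivD derivC addr0.
move: d2; rewrite dE derivD !derivM derivD derivC addr0 /root !(hornerD, hornerM, hornerC).
by rewrite (rootP Vd) Vy addNr !mulr0 !add0r mulf_eq0 (negPf r0).
Qed.

Let diff_prod_disc qR qS :
  yL qR = diff_prod rigid -> yL qS = diff_prod swappable ->
  map_poly (@ratr algC) qR * map_poly (@ratr algC) qS = disc.
Proof.
move=> qRE qSE; apply: eq_poly_nat => n; rewrite hornerM.
have [S] := specialize n%:R.
rewrite (diff_prod_ev S qRE) (diff_prod_ev S qSE) (disc_horner (ev_factor S) cardT).
rewrite pair_big_dep /= [RHS](bigID (fun p : T * T => tperm p.1 p.2 \in galPerm L)) /= mulrC.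
by congr (_ * _); apply: eq_bigl => p; rewrite eq_sym.
Qed.

Let rigid_degree qR qS :
  yL qR = diff_prod rigid -> yL qS = diff_prod swappable ->
  ((size qR).-1 <= 2 * a.-1)%N.
Proof.
move=> qRE qSE; have discE := diff_prod_disc qRE qSE.
set W := map_poly _ qR in discE.
have q0 : qR != 0.
  by apply: contraNneq disc_neq0 => q0; rewrite -discE /W q0 rmorph0 mul0r.
have [rs WE] := closed_field_poly_normal W.
have lc0 : lead_coef W != 0 by rewrite lead_coef_eq0 map_poly_eq0.
have -> : (size qR).-1 = size rs.
  by rewrite -(size_map_poly (@ratr algC)) -/W WE size_scale // size_prod_XsubC.
have rootsW y : y \in rs -> root W y by rewrite WE rootZ // root_prod_XsubC.
have dbl y : y \in rs -> root disc y /\ root VC^`() y.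
  move=> /rootsW Wy; have Wy' := rigid_multiple_root qRE q0 Wy.
  have Dy : root disc y by rewrite -discE rootM Wy.
  split=> //; apply: disc_double_root => //.
  by rewrite -discE derivM /root hornerD !hornerM (rootP Wy) (rootP Wy') !mul0r addr0.
apply: leq_trans (size_le_double_undup _) _ => [y|].
  rewrite leqNgt; apply/negP => y3.
  have : ('X - y%:P) ^+ 3 %| W.
    rewrite -mup_geq ?map_poly_eq0 //.
    rewrite WE -mul_polyC mupMr ?mu_prod_XsubC //.
    by rewrite /root hornerC.
  case/dvdpP=> p Wp; have /eqP[] := disc_no_triple_root y (p * map_poly (@ratr algC) qS).
  by rewrite -discE Wp [RHS]mulrA; congr (_ * _); rewrite mulrC.
(* Since V is Morse, y -> -V(y) maps the distinct zeros of [W] injectively into the critical values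
   of U. *)
rewrite leq_mul2l /= -size_crit -(size_map (fun y => - VC.[y])) -(size_map (fun z => UC.[z]) crit).
apply: uniq_leq_size => [|_ /mapP[y yrs ->]].
  rewrite map_inj_in_uniq ?undup_uniq // => y y'; rewrite !mem_undup.
  by move=> /dbl[_ Vy] /dbl[_ Vy'] /oppr_inj; case: morseV => _; apply.
move: yrs; rewrite mem_undup => /dbl[/disc_root[z zc ->] _].
by rewrite opprK map_f.
Qed.

(** The lower bound on the degree of the rigid product is obtained from this upper bound for the
    complementary product, the two degrees adding up to that of [disc]. It holds because U(x) =
    -V(n) forces |x|^a = O(n^deg V). *)
Let swappable_degree qS : yL qS = diff_prod swappable -> qS != 0 ->
  (a * (size qS).-1 <= #|swappable| * (size V).-1)%N.
Proof.
move=> qSE q0; set v := (size V).-1; set W := map_poly (@ratr algC) qS.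
have W0 : W != 0 by rewrite map_poly_eq0.
have UC0 : UC != 0 by rewrite map_poly_eq0 monic_neq0.
have [CU CU0 leU] := le_exprn_poly UC0; have [CV CV0 leV] := horner_nat_le VC.
have [CW CW0 leW] := le_exprn_poly W0.
move: leU leV leW; rewrite size_map_poly -/a sizeVC -/v size_map_poly.
move=> leU leV leW; set d := (size qS).-1 in leW *; set e := #|swappable|.
pose CT := 2 ^+ a * (CU * (1 + CV) *+ 2).
have CT0 : 0 <= CT by rewrite !(mulr_ge0, exprn_ge0, addr_ge0, mulrn_wge0).
(* All estimates are raised to the power a, which avoids the fractional exponent deg V / a. *)
rewrite mulnC; apply: (@expn_degree_le _ (CW ^+ a * (2 ^+ a * (1 + CT ^+ e)))) => n n_gt0.
have n0 : 0 <= n%:R :> algC by rewrite ler0n.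
have n1 k : 1 <= n%:R ^+ k :> algC by rewrite exprn_ege1 // ler1n.
have [S] := specialize n%:R.
have le_root t : `|ev S t| ^+ a <= CU * (1 + CV) * n%:R ^+ v.
  apply: le_trans (leU _) _; rewrite -mulrA ler_wpM2l //.
  rewrite mulrDl mul1r lerD // (le_trans _ (leV n n_gt0)) //.
  have : (UC + (VC.[n%:R])%:P).[ev S t] = 0.
    by rewrite (ev_factor S) horner_prod (bigD1 t) //= hornerXsubC subrr mul0r.
  by rewrite hornerD hornerC => /eqP; rewrite addr_eq0 => /eqP ->; rewrite normrN.
have le_diff t u : `|ev S t - ev S u| ^+ a <= CT * n%:R ^+ v.
  apply: (@le_trans _ _ ((`|ev S t| + `|ev S u|) ^+ a)).
    by rewrite lerXn2r ?nnegrE ?addr_ge0 // ler_normB.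
  apply: le_trans (exprD_le _ _ _) _ => //.
  by rewrite /CT -mulrA ler_pM2l ?exprn_gt0 // mulrnAl mulr2n lerD.
have leW' : `|W.[n%:R]| ^+ a <= CT ^+ e * n%:R ^+ (e * v).
  rewrite (diff_prod_ev S qSE) normr_prod -prodrXl mulnC exprM -exprMn /e -prodr_const.
  by apply: ler_prod => p _; rewrite exprn_ge0 //= le_diff.
rewrite exprM; apply: (@le_trans _ _ ((CW * (1 + `|W.[n%:R]|)) ^+ a)).
  have := leW n%:R; rewrite normr_nat => leWn.
  by rewrite lerXn2r ?nnegrE ?exprn_ge0 ?mulr_ge0 ?addr_ge0.
rewrite exprMn -!mulrA ler_wpM2l ?exprn_ge0 //.
apply: le_trans (exprD_le _ _ _) _ => //; rewrite ler_wpM2l ?exprn_ge0 //.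
by rewrite expr1n mulrDl mul1r lerD.
Qed.

(** By transitivity of exchangeability, no w is exchangeable with both t and u; [f w] picks a
    partner making a rigid pair with w. The a - 1 pairs so obtained are counted in both orders. *)
Let rigid_card t u : t != u -> tperm t u \notin galPerm L ->
  (2 * a.-1 <= #|rigid|)%N.
Proof.
move=> tu ntu; pose f w : T := if tperm t w \in galPerm L then u else t.
have rigid_f w : w != t -> rigid (f w, w).
  move=> wt; rewrite /rigid /f /=; case: ifP => tw; last by rewrite eq_sym wt tw.
  have uw : u != w by apply: contraNneq ntu => ->.
  rewrite uw /=; apply: contra ntu => uwG.
  by rewrite -(tpermJ_tperm (x := w)) ?groupJ // 1?eq_sym //; rewrite tpermC.
pose A := [set (f w, w) | w in [set~ t]]; pose B := [set (w, f w) | w in [set~ t]].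
(* As [f] only takes the values t and u, a common pair would be (u, u), whereas [f u] is t. *)
have AB : A :&: B = set0.
  apply/setP => p; rewrite !inE; apply/negP => /andP[/imsetP[w]].
  rewrite !inE => wt -> /imsetP[w']; rewrite !inE => w't [fw wf].
  have f_u v : f v != t -> f v = u by rewrite /f; case: ifP => // _; rewrite eqxx.
  have w'u : w' = u by rewrite -fw f_u // fw.
  have wu : w = u by rewrite wf f_u // -wf.
  by move: w't; rewrite -fw wu /f (negPf ntu) eqxx.
have cA : #|A| = a.-1 by rewrite card_imset ?cardsC1 ?cardT // => w w' [].
have cB : #|B| = a.-1 by rewrite card_imset ?cardsC1 ?cardT // => w w' [].
have <- : #|A :|: B| = (2 * a.-1)%N by rewrite cardsU AB cards0 subn0 cA cB mul2n addnn.
apply/subset_leq_card/subsetP => p; rewrite inE => /orP[]/imsetP[w]; rewrite !inE => wt ->.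
  exact: rigid_f.
have := rigid_f w wt; rewrite /rigid unfold_in /= => /andP[fw nG].
by rewrite /in_mem /= eq_sym fw tpermC.
Qed.

Lemma galPerm_sum_full : galPerm L = [set: {perm T}]%G.
Proof.
have [qR qRE] := diff_prod_descends rigid_stable.
have [qS qSE] := diff_prod_descends swappable_stable.
have discE := diff_prod_disc qRE qSE.
have [qR0 qS0] : qR != 0 /\ qS != 0.
  by split; apply: contraNneq disc_neq0 => q0; rewrite -discE q0 rmorph0 ?mul0r ?mulr0.
have degE : ((size qR).-1 + (size qS).-1 = a.-1 * (size V).-1)%N.
  have := congr1 (fun p : {poly algC} => (size p).-1) discE.
  rewrite size_disc size_mul ?map_poly_eq0 // !size_map_poly => <-.
  move: qR0 qS0; rewrite -!size_poly_gt0.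
  by case: (size qR) (size qS) => [|m] [|n] //; rewrite addSn addnS.
have cardRS : (#|rigid| + #|swappable| = a * a.-1)%N.
  rewrite -!sum1_card addnC.
  transitivity (\sum_(p : T * T | p.1 != p.2) 1)%N.
    by rewrite [RHS](bigID (fun p => tperm p.1 p.2 \in galPerm L)).
  rewrite -(pair_big_dep predT (fun t u : T => t != u) (fun _ _ => 1%N)) /=.
  rewrite (eq_bigr (fun=> a.-1)) => [|t _]; first by rewrite sum_nat_const cardT.
  by rewrite sum1_card -cardT -(cardC1 t); apply: eq_card => u; rewrite !inE /= eq_sym.
have leR := rigid_degree qRE qSE; have leS := swappable_degree qSE qS0.
have rigid0 t u : t != u -> tperm t u \in galPerm L.
  move=> tu; apply/negPn/negP => ntu; have := rigid_card tu ntu.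
  have a1 : (0 < a.-1)%N.
    by rewrite -subn1 subn_gt0 -cardT; apply/card_gt1P; exists t, u.
  have av : (a < (size V).-1)%N.
    by rewrite /a; move: sizeU sizeV; case: (size U) (size V) => [|m] [|n].
  (* Write v = deg V, r for the number of rigid pairs and d for the degree of their product.
     Subtracting [leS] from a times [degE] gives r v <= a d; with r >= 2(a-1) >= d and a > 1 this
     yields v <= a, against [av]. *)
  move: leR leS cardRS degE a1 av; clear; rewrite -/a.
  move: (size V).-1 #|rigid| #|swappable| (size qR).-1 (size qS).-1 a.
  by move=> v nr ns dr ds a0; nia.
apply/val_inj/eqP; rewrite /= -subTset; apply/subsetP => s _.
have [ts -> /allP tsP] := prod_tpermP s.
by rewrite big_seq group_prod // => p /tsP; apply: rigid0.
Qed.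

Lemma card_sum_roots : #|{: T}| = (size U).-1.
Proof. exact: cardT. Qed.

End SumOfPolynomials.

(** * The Tutte polynomial of a uniform matroid *)

Lemma perm_isog (T1 T2 : finType) :
  #|T1| = #|T2| -> [set: {perm T1}] \isog [set: {perm T2}].
Proof.
move=> eqT; have [h [h' hK h'K]] : exists h : T1 -> T2, bijective h.
  exists (fun x => enum_val (cast_ord eqT (enum_rank x))) => //.
  exists (fun y => enum_val (cast_ord (esym eqT) (enum_rank y))) => x;
    by rewrite enum_valK ?cast_ordK ?cast_ordKV enum_rankK.
have inj s : injective (h \o @fun_of_perm T1 s \o h').
  by apply: inj_comp (can_inj h'K); apply: inj_comp (can_inj hK) perm_inj.
pose f s := perm (@inj s).
have fM : {in setT &, {morph f : s t / (s * t)%g}}.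
  by move=> s t _ _; apply/permP => x; rewrite permM !permE /= permM hK.
pose phi := Morphism fM.
have phi_inj : ('injm phi)%g.
  apply/injmP => s t _ _ /permP st; apply/permP => x.
  by have := st (h x); rewrite !permE /= hK => /(can_inj hK).
have <- : (phi @* setT)%g = [set: {perm T2}].
  apply/eqP; rewrite eqEcard subsetT /= card_injm ?subsetT //.
  by rewrite -/('Sym_T2)%g -/('Sym_T1)%g !card_Sym eqT.
exact: sub_isog.
Qed.

Lemma comp_binom_trunc (R : comNzRingType) a b (q : {poly R}) :
  binom_trunc R a b \Po q = \sum_(0 <= i < a.+1) q ^+ (a - i) *+ 'C(b, i).
Proof.
rewrite big_nat_rev /= big_mkord /binom_trunc poly_def raddf_sum /=.
apply: eq_bigr => i _; rewrite comp_polyZ comp_Xn_poly scaler_nat add0n subSS.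
by rewrite subKn // -ltnS.
Qed.

(** Reversing j to b - j turns the sum in y into the truncated binomial of degree b - a, short of
    its constant term C(b, a). *)
Lemma tutteU_sum a b : (a < b)%N ->
  tutteUQy a b = sumQy (binom_trunc rat a b \Po ('X - 1%:P))
    ((binom_trunc rat (b - a) b - 'C(b, a)%:R%:P) \Po ('X - 1%:P)).
Proof.
move=> ab; rewrite /tutteUQy /sumQy /tutteU; congr (map_poly _ (_ + _%:P)).
  rewrite comp_binom_trunc rmorph_sum; apply: eq_bigr => i _.
  by rewrite rmorphMn rmorphXn rmorphB /= map_polyX map_polyC.
rewrite raddfB /= comp_polyC comp_binom_trunc [X in _ = X - _]big_nat_recr //= subnn expr0.
rewrite bin_sub ?(ltnW ab) // polyC_natr addrK.
rewrite -{1}[a.+1]add0n big_addn subSS big_nat_rev /=; apply: eq_big_nat => i /andP[_ ib].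
by rewrite -(bin_sub (_ : i <= b)%N); [congr (_ ^+ _ *+ 'C(_, _)); lia | lia].
Qed.

Lemma galPerm_tutteU a b (L : splitting_ext (tutteUQy a b)) :
    (0 < a)%N -> (2 * a < b)%N ->
  galPerm L = [set: {perm seq_sub (spl_roots L)}]%G /\ #|{: seq_sub (spl_roots L)}| = a.
Proof.
move=> a0 ab2; have ab : (a < b)%N by lia.
move: L; rewrite tutteU_sum // => L.
have size_lin (R : nzRingType) : size ('X - 1%:P : {poly R}) = 2 by rewrite size_XsubC.
have sizeU : size (binom_trunc rat a b \Po ('X - 1%:P)) = a.+1.
  by rewrite size_comp_poly2 ?size_lin // size_binom_trunc.
have sizeV : size ((binom_trunc rat (b - a) b - 'C(b, a)%:R%:P) \Po ('X - 1%:P)) = (b - a).+1.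
  rewrite size_comp_poly2 ?size_lin // size_polyDl size_binom_trunc //.
  by rewrite size_polyN (leq_ltn_trans (size_polyC_leq1 _)) // ltnS subn_gt0.
have monicU : binom_trunc rat a b \Po ('X - 1%:P) \is monic.
  rewrite monicE lead_coef_comp ?size_lin // lead_coefXsubC expr1n mulr1.
  by rewrite /binom_trunc lead_coef_poly // subnn bin0 ?oner_neq0.
have lt_ab : (a < b - a)%N by lia.
split; last by rewrite card_sum_roots ?sizeU ?sizeV.
apply: galPerm_sum_full; rewrite ?sizeU ?sizeV //.
- rewrite map_comp_poly map_binom_trunc rmorphB /= map_polyX map_polyC /= rmorph1.
  by apply: (@morse_translate algC); apply: (@morse_binom_trunc algC); rewrite a0.
- rewrite map_comp_poly [map_poly _ ('X - _)]rmorphB /= map_polyX map_polyC /= rmorph1.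
  rewrite rmorphB /= map_binom_trunc map_polyC /=.
  apply: (@morse_translate algC); apply: (@morse_addC algC _ (ratr 'C(b, a)%:R)).
  by rewrite subrK; apply: (@morse_binom_trunc algC); lia.
Qed.

Theorem theorem4p9 (a : nat) (ha : (2 <= a)%N) :
  (exists N : nat, forall b : nat, (a < b)%N -> (N <= b)%N ->
     forall L : splitting_ext (tutteUQy a b),
       galPerm L \isog [set: {perm 'I_a}])
  /\
  (forall b p : nat, prime p -> (a < p)%N -> b = (a + p)%N ->
     forall L : splitting_ext (tutteUQy a b),
       [primitive galPerm L, on [set: seq_sub (spl_roots L)] | 'P]
       /\ (~~ prime a ->
           [transitive^2 galPerm L, on [set: seq_sub (spl_roots L)] | 'P])).
Proof.
split.
  exists (2 * a).+1 => b _ ab L; have [-> cardT] := galPerm_tutteU L (ltnW ha) ab.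
  by apply: perm_isog; rewrite cardT card_ord.
(* From p > a follows b = a + p > 2a, so the group is again fully symmetric, on a >= 2 points:
   doubly transitive, hence primitive. *)
move=> b p _ ap bE L; have ab : (2 * a < b)%N by lia.
have [-> cardT] := galPerm_tutteU L (ltnW ha) ab.
have tr2 : [transitive^2 [set: {perm seq_sub (spl_roots L)}]%G,
    on [set: seq_sub (spl_roots L)] | 'P].
  by apply: ntransitive_weak (Sym_trans _); rewrite cardT.
by split=> //; apply: ntransitive_primitive tr2.
Qed.
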